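(* Let $G^+=\langle L\mid R\rangle_{mo}$ be a positively presented atomic monoid that carries a fundamental element $\Delta$. Then $G^+$ satisfies the left LCM condition if and only if it satisfies the right GCD condition; likewise, $G^+$ satisfies the right LCM condition if and only if it satisfies the left GCD condition.
   Context: $L$ is a finite set, $R$ a finite set of relations $R_i=S_i$ between positive words (words in the free monoid $L^*$), and $G^+=\langle L\mid R\rangle_{mo}$ is the quotient of $L^*$ by the congruence generated by $R$. $G^+$ is atomic if there is a map $\nu:G^+\to\mathbb{Z}_{\ge 0}$ with $\nu(\alpha)=0\iff\alpha=1$ and $\nu(\alpha\beta)\ge\nu(\alpha)+\nu(\beta)$ for all $\alpha,\beta$. An atom is an element $\alpha\ne 1$ such that $\alpha=\beta\gamma$ implies $\beta=1$ or $\gamma=1$. A generator $g\in L$ is a dummy generator if $R$ contains a relation $g=w$ with $w$ a positive word in the generators other than $g$; $\widetilde L$ is the set of non-dummy generators. Its image in $G^+$ is the set of all atoms, and $\widetilde L$ is identified with this image. A fundamental element is an element $\Delta\in G^+$ for which there is a permutation $\sigma$ of $\widetilde L$ such that for every $s\in\widetilde L$ there is $\Delta_s\in G^+$ with $\Delta=s\cdot\Delta_s=\Delta_s\cdot\sigma(s)$. (The identity is not a fundamental element.) $U$ divides $V$ from the left (right) if $V=UW$ (resp. $V=WU$) for some $W\in G^+$. A right least common multiple of $U,V$ is an element that is left-divisible by $U$ and $V$ and divides from the left every element left-divisible by both $U$ and $V$; a left least common multiple is defined symmetrically, with right-divisibility. A left greatest common divisor of $U,V$ is a common left divisor of $U$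 and $V$ that is left-divisible by every common left divisor; a right greatest common divisor is defined symmetrically. $G^+$ satisfies the left (right) LCM condition if any two elements have a left (right) least common multiple, and the left (right) GCD condition if any two elements have a left (right) greatest common divisor. *)

(* Defs.v *)
From HB Require Import structures.
From mathcomp Require Import all_boot.
From mathcomp Require Import boolp classical_sets functions.

Set Implicit Arguments.
Unset Strict Implicit.
Unset Printing Implicit Defensive.

Local Open Scope quotient_scope.
Local Open Scope classical_set_scope.

(* The smallest congruence on the free monoid [seq L] that contains [R]. *)
Inductive congruence (L : finType) (R : seq (seq L * seq L)) :
    seq L -> seq L -> Prop :=
| cong_rel u v : (u, v) \in R -> congruence R u v
| cong_refl u : congruence R u u
| cong_sym u v : congruence R u v -> congruence R v u
| cong_trans u v w : congruence R u v -> congruence R v w -> congruence R u w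
| cong_cat u u' v v' :
    congruence R u u' -> congruence R v v' -> congruence R (u ++ v) (u' ++ v').

Section PresentedMonoid.
Variables (L : finType) (R : seq (seq L * seq L)).

Definition congb : rel (seq L) := fun u v => `[< congruence R u v >].

Lemma congb_refl : reflexive congb.
Proof. by move=> u; apply/asboolP; apply: cong_refl. Qed.

Lemma congb_sym : symmetric congb.
Proof. by move=> u v; apply/asboolP/asboolP; apply: cong_sym. Qed.

Lemma congb_trans : transitive congb.
Proof.
by move=> v u w /asboolP uv /asboolP vw; apply/asboolP; apply: cong_trans vw.
Qed.

Canonical congb_equiv := EquivRel congb congb_refl congb_sym congb_trans.

(* <L | R>_mo; the word problem is undecidable in general, hence the
   classical quotient. *)
Definition presented_monoid := {eq_quot congb_equiv}.
HB.instance Definition _ := Choice.on presented_monoid.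
HB.instance Definition _ := EqQuotient.on presented_monoid.

Definition word_class (u : seq L) : presented_monoid := \pi u.

Lemma word_classE u v : word_class u = word_class v <-> congruence R u v.
Proof. by split=> [/eqmodP/asboolP|uv] //; apply/eqmodP/asboolP. Qed.

Lemma congruence_repr u : congruence R (repr (word_class u)) u.
Proof. by apply/word_classE; rewrite /word_class reprK. Qed.

Definition presented_mul (x y : presented_monoid) : presented_monoid :=
  word_class (repr x ++ repr y).

Lemma word_class_cat u v :
  presented_mul (word_class u) (word_class v) = word_class (u ++ v).
Proof. by apply/word_classE; apply: cong_cat; apply: congruence_repr. Qed.

Lemma presented_mulA : associative presented_mul.
Proof.
move=> x y z; rewrite -(reprK x) -(reprK y) -(reprK z) -!/(word_class _).
by rewrite !word_class_cat catA.
Qed.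

Lemma presented_mul1 : left_id (word_class [::]) presented_mul.
Proof. by move=> x; rewrite -(reprK x) -/(word_class _) word_class_cat. Qed.

Lemma presented_mulr1 : right_id (word_class [::]) presented_mul.
Proof.
by move=> x; rewrite -(reprK x) -/(word_class _) word_class_cat cats0.
Qed.

HB.instance Definition _ :=
  isMonoid.Build presented_monoid presented_mulA presented_mul1 presented_mulr1.

End PresentedMonoid.

Local Open Scope group_scope.

Section MonoidNotions.
Variable M : monoidType.
Implicit Types x y z d m : M.

Definition atomic : Prop :=
  exists nu : M -> nat,
    (forall x, nu x = 0 <-> x = 1) /\
    (forall x y, (nu x + nu y <= nu (x * y)%g)%N).

Definition atoms : set M :=
  [set x | x <> 1 /\ forall y z, x = y * z -> y = 1 \/ z = 1].

Definition divides_left x y : Prop := exists z, y = x * z.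
Definition divides_right x y : Prop := exists z, y = z * x.

(* Right lcms are taken for left-divisibility, left lcms for
   right-divisibility; left and right gcds follow the side of divisibility. *)
Definition is_right_lcm x y m : Prop :=
  [/\ divides_left x m, divides_left y m &
      forall z, divides_left x z -> divides_left y z -> divides_left m z].
Definition is_left_lcm x y m : Prop :=
  [/\ divides_right x m, divides_right y m &
      forall z, divides_right x z -> divides_right y z -> divides_right m z].
Definition is_left_gcd x y d : Prop :=
  [/\ divides_left d x, divides_left d y &
      forall z, divides_left z x -> divides_left z y -> divides_left z d].
Definition is_right_gcd x y d : Prop :=
  [/\ divides_right d x, divides_right d y &
      forall z, divides_right z x -> divides_right z y -> divides_right z d].

Definition left_lcm_condition : Prop := forall x y, exists m, is_left_lcm x y m.
Definition right_lcm_condition : Prop :=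
  forall x y, exists m, is_right_lcm x y m.
Definition left_gcd_condition : Prop := forall x y, exists d, is_left_gcd x y d.
Definition right_gcd_condition : Prop :=
  forall x y, exists d, is_right_gcd x y d.

End MonoidNotions.

Arguments atomic : clear implicits.
Arguments atoms : clear implicits.
Arguments left_lcm_condition : clear implicits.
Arguments right_lcm_condition : clear implicits.
Arguments left_gcd_condition : clear implicits.
Arguments right_gcd_condition : clear implicits.

Section Fundamental.
Variables (L : finType) (R : seq (seq L * seq L)).

(* Relations are unoriented: [g = w] may be listed in [R] on either side. *)
Definition dummy (g : L) : Prop :=
  exists w : seq L,
    g \notin w /\ (([:: g], w) \in R \/ (w, [:: g]) \in R).

(* The set of non-dummy generators, identified with its image in the monoid.
   That this image is the set of all atoms fails for degenerate presentations
   (in <a, b | a = b> both generators are dummy), so this equality has to be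
   assumed separately: without it a fundamental element need not be a common
   multiple of the atoms. *)
Definition Ltilde : set (presented_monoid R) :=
  [set word_class R [:: g] | g in [set g : L | ~ dummy g]].

(* A permutation of [Ltilde] is a map whose restriction to [Ltilde] is a
   bijection onto [Ltilde]; its values elsewhere are irrelevant. [Delta <> 1]
   only matters when [Ltilde] is empty. *)
Definition fundamental (Delta : presented_monoid R) : Prop :=
  Delta <> 1 /\
  exists sigma : presented_monoid R -> presented_monoid R,
    set_bij Ltilde Ltilde sigma /\
    forall s, Ltilde s ->
      exists Delta_s, Delta = s * Delta_s /\ Delta = Delta_s * sigma s.

End Fundamental.

Arguments dummy {L} R g.
Arguments Ltilde {L} R.
Arguments fundamental {L R} Delta.

(* Main.v *)
Require Import Defs.
From mathcomp Require Import all_boot.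
From mathcomp Require Import boolp classical_sets functions.

(** Both equivalences are the lattice-theoretic fact that, for a relation with
    enough chain conditions, pairwise joins and pairwise meets imply each other
    as soon as every pair is bounded on the other side: a meet of [x] and [y]
    is a maximal element [d] of the set of their common lower bounds, because
    the join of [d] with another common lower bound is again a common lower
    bound above [d], hence equal to [d] ([meets_of_joins]). The converse is the
    same statement for the opposite relation.

    Atomicity supplies the chain conditions. If [y = x * z], then either
    [z = 1] and [x = y], or [nu x < nu y]; so [nu] makes both divisibility
    relations strictly ranked, even though the monoid need not be cancellative.

    Common lower bounds are trivial, since [1] divides everything. Common
    upper bounds come from [Delta]. From [Delta = s * Delta_s] and
    [Delta = Delta_s * sigma s] one gets [s * Delta = Delta * sigma s], so an
    element can be carried across [Delta] in either direction; and every atom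
    divides [Delta] on both sides. Consequently a product of [n] atoms divides
    [Delta ^+ n] on both sides, and as atoms generate, any two elements divide
    a common power of [Delta]. *)

Set Implicit Arguments.
Unset Strict Implicit.
Unset Printing Implicit Defensive.

Local Open Scope group_scope.

(** * Joins and meets for ranked relations *)

(** The join of a maximal common lower bound [d] with another one is again a
    common lower bound, so maximality makes it equal to [d]. The rank only has
    to decrease below a fixed [x], so that the lemma also covers relations
    whose chains are bounded on one side only. *)
Lemma meets_of_joins (T : Type) (le : T -> T -> Prop) :
  (forall x, exists r : T -> nat, forall d e,
     le d x -> le e x -> le d e -> d = e \/ (r e < r d)%N) ->
  (forall x y, exists d, le d x /\ le d y) ->
  (forall x y, exists m,
     [/\ le x m, le y m & forall z, le x z -> le y z -> le m z]) ->
  forall x y, exists d,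
    [/\ le d x, le d y & forall z, le z x -> le z y -> le z d].
Proof.
move=> ranked bounded joins x y; have [r rP] := ranked x.
pose P n := `[< exists d, [/\ le d x, le d y & r d = n] >].
have exP : exists n, P n.
  by have [d [dx dy]] := bounded x y; exists (r d); apply/asboolP; exists d.
have [_ /asboolP[d [dx dy <-]] d_min] := ex_minnP exP.
exists d; split=> // z zx zy; have [m [dm zm m_min]] := joins d z.
have [mx my] : le m x /\ le m y by split; apply: m_min.
have [->//|] := rP d m dx mx dm.
by rewrite ltnNge d_min //; apply/asboolP; exists m.
Qed.

(** A rank bounded below controls descending chains directly; below a fixed
    [x], the deficit [nu x - nu d] controls ascending ones. *)
Lemma joins_iff_meets (T : Type) (le : T -> T -> Prop) (nu : T -> nat) :
  (forall x y, le x y -> x = y \/ (nu x < nu y)%N) ->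
  (forall x y, exists d, le d x /\ le d y) ->
  (forall x y, exists u, le x u /\ le y u) ->
  (forall x y, exists m,
     [/\ le x m, le y m & forall z, le x z -> le y z -> le m z]) <->
  (forall x y, exists d,
     [/\ le d x, le d y & forall z, le z x -> le z y -> le z d]).
Proof.
move=> nu_lt lower upper; split.
  apply: meets_of_joins => // x; exists (fun d => nu x - nu d) => d e dx ex de.
  have [|lt_de] := nu_lt d e de; [by left | right].
  have le_ex : (nu e <= nu x)%N by have [->//|/ltnW] := nu_lt e x ex.
  by rewrite ltn_sub2l // (leq_trans lt_de).
apply: (meets_of_joins (le := fun x y => le y x)) => // x; exists nu => d e _ _.
by move=> /nu_lt[->|]; [left | right].
Qed.

(** * Atomic monoids *)

(** A nontrivial element that is not an atom splits into two factors of
    smaller [nu], so atoms generate. *)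
Lemma atomic_ind (M : monoidType) (P : M -> Prop) :
  atomic M -> P 1 -> (forall s, atoms M s -> P s) ->
  (forall x y, P x -> P y -> P (x * y)) -> forall x, P x.
Proof.
move=> [nu [nu1 nuM]] P1 Patom PM x.
have [n] := ubnP (nu x); elim: n x => // n IHn x lt_xn.
have nu_gt0 z : z <> 1 -> (0 < nu z)%N.
  by move=> z_neq1; rewrite lt0n; apply/eqP => /nu1.
have [->//|x_neq1] := pselect (x = 1).
have [|not_atom] := pselect (atoms M x); first exact: Patom.
have [y [z [xE y_neq1 z_neq1]]] : exists y z, [/\ x = y * z, y <> 1 & z <> 1].
  apply: contrapT => no_split; apply: not_atom; split=> // y z xE.
  have [|y_neq1] := pselect (y = 1); [by left | right].
  by apply: contrapT => z_neq1; apply: no_split; exists y, z.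
have lt_yz : (nu y + nu z <= n)%N.
  by rewrite (leq_trans (nuM y z)) // -xE -ltnS.
rewrite xE; apply: PM; apply: IHn; apply: leq_trans lt_yz.
  by rewrite -addn1 leq_add2l nu_gt0.
by rewrite -add1n leq_add2r nu_gt0.
Qed.

(** The factor witnessing a proper divisibility is not [1], hence has positive
    [nu]. *)
Lemma divides_left_ranked (M : monoidType) (nu : M -> nat) :
  (forall x, nu x = 0 <-> x = 1) ->
  (forall x y, (nu x + nu y <= nu (x * y)%g)%N) ->
  forall x y, divides_left x y -> x = y \/ (nu x < nu y)%N.
Proof.
move=> nu1 nuM x _ [z ->]; have [/nu1->|z_gt0] := posnP (nu z).
  by left; rewrite mulg1.
by right; apply: leq_trans (nuM x z); rewrite -addn1 leq_add2l.
Qed.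

Lemma divides_right_ranked (M : monoidType) (nu : M -> nat) :
  (forall x, nu x = 0 <-> x = 1) ->
  (forall x y, (nu x + nu y <= nu (x * y)%g)%N) ->
  forall x y, divides_right x y -> x = y \/ (nu x < nu y)%N.
Proof.
move=> nu1 nuM x _ [z ->]; have [/nu1->|z_gt0] := posnP (nu z).
  by left; rewrite mul1g.
by right; apply: leq_trans (nuM z x); rewrite -add1n leq_add2r.
Qed.

(** * Common multiples from a quasi-central element *)

(** Elements cross [Delta] one atom at a time. *)
Lemma cross_rightward (M : monoidType) (Delta : M) :
  atomic M ->
  (forall s, atoms M s -> exists t, s * Delta = Delta * t) ->
  forall n x, exists y, x * Delta ^+ n = Delta ^+ n * y.
Proof.
move=> M_atomic cross.
have cross1 x : exists y, x * Delta = Delta * y.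
  elim/atomic_ind: x => //; first by exists 1; rewrite mul1g mulg1.
  move=> x y [x' xE] [y' yE]; exists (x' * y').
  by rewrite -mulgA yE mulgA xE mulgA.
elim=> [|n IHn] x; first by exists x; rewrite expg0 mulg1 mul1g.
have [y yE] := cross1 x; have [z zE] := IHn y.
by exists z; rewrite expgS mulgA yE -mulgA zE mulgA.
Qed.

Lemma cross_leftward (M : monoidType) (Delta : M) :
  atomic M ->
  (forall s, atoms M s -> exists t, Delta * s = t * Delta) ->
  forall n x, exists y, Delta ^+ n * x = y * Delta ^+ n.
Proof.
move=> M_atomic cross.
have cross1 x : exists y, Delta * x = y * Delta.
  elim/atomic_ind: x => //; first by exists 1; rewrite mul1g mulg1.
  move=> x y [x' xE] [y' yE]; exists (x' * y').
  by rewrite mulgA xE -mulgA yE mulgA.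
elim=> [|n IHn] x; first by exists x; rewrite expg0 mulg1 mul1g.
have [y yE] := cross1 x; have [z zE] := IHn y.
by exists z; rewrite expgSr -mulgA yE mulgA zE mulgA.
Qed.

(** If [Delta ^+ m = x * a] and [Delta ^+ n = y * b], then
    [Delta ^+ (m + n) = x * a * Delta ^+ n], and carrying [a] across
    [Delta ^+ n] brings [y] next to [x]. *)
Lemma divides_left_power (M : monoidType) (Delta : M) :
  atomic M ->
  (forall s, atoms M s -> exists t, s * Delta = Delta * t) ->
  (forall s, atoms M s -> divides_left s Delta) ->
  forall x, exists n, divides_left x (Delta ^+ n).
Proof.
move=> M_atomic cross atom_div x; elim/atomic_ind: x => //.
- by exists 0, 1; rewrite mulg1.
- by move=> s /atom_div; exists 1%N.
move=> x y [m [a mE]] [n [b nE]]; exists (m + n).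
have [a' aE] := cross_rightward M_atomic cross n a.
by exists (b * a'); rewrite expgnDr mE -mulgA aE nE !mulgA.
Qed.

Lemma divides_right_power (M : monoidType) (Delta : M) :
  atomic M ->
  (forall s, atoms M s -> exists t, Delta * s = t * Delta) ->
  (forall s, atoms M s -> divides_right s Delta) ->
  forall x, exists n, divides_right x (Delta ^+ n).
Proof.
move=> M_atomic cross atom_div x; elim/atomic_ind: x => //.
- by exists 0, 1; rewrite mulg1.
- by move=> s /atom_div; exists 1%N.
move=> x y [m [a mE]] [n [b nE]]; exists (n + m).
have [b' bE] := cross_leftward M_atomic cross m b.
by exists (b' * a); rewrite addnC expgnDr nE mulgA bE mE !mulgA.
Qed.

Lemma common_right_multiple (M : monoidType) (Delta : M) :
  (forall x : M, exists n, divides_left x (Delta ^+ n)) ->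
  forall x y : M, exists u, divides_left x u /\ divides_left y u.
Proof.
move=> power_div x y.
have [m [a mE]] := power_div x; have [n [b nE]] := power_div y.
exists (Delta ^+ (m + n)); split; [exists (a * Delta ^+ n) | exists (b * Delta ^+ m)].
  by rewrite expgnDr mE mulgA.
by rewrite addnC expgnDr nE mulgA.
Qed.

Lemma common_left_multiple (M : monoidType) (Delta : M) :
  (forall x : M, exists n, divides_right x (Delta ^+ n)) ->
  forall x y : M, exists u, divides_right x u /\ divides_right y u.
Proof.
move=> power_div x y.
have [m [a mE]] := power_div x; have [n [b nE]] := power_div y.
exists (Delta ^+ (m + n)); split; [exists (Delta ^+ n * a) | exists (Delta ^+ m * b)].
  by rewrite addnC expgnDr mE mulgA.
by rewrite expgnDr nE mulgA.
Qed.

(** * Fundamental elements *)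

(** Both expressions of [Delta] give [s * Delta = s * Delta_s * sigma s
    = Delta * sigma s]. The two statements about the right side concern
    [sigma s] rather than [s], which is why [sigma] must be onto. *)
Lemma fundamental_cross (L : finType) (R : seq (seq L * seq L))
    (Delta : presented_monoid R) :
  fundamental Delta -> forall s, Ltilde R s ->
  [/\ exists t, s * Delta = Delta * t, divides_left s Delta,
      exists t, Delta * s = t * Delta & divides_right s Delta].
Proof.
move=> [_ [sigma [[_ _ sigma_onto] DeltaE]]] s Ls.
have cross t : Ltilde R t -> t * Delta = Delta * sigma t.
  by move=> /DeltaE[c [lE rE]]; rewrite {1}rE {1}lE mulgA.
have [c [lE _]] := DeltaE s Ls; have [t Lt sE] := sigma_onto s Ls.
have [b [_ rE]] := DeltaE t Lt; rewrite sE in rE.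
split; [by exists (sigma s); apply: cross | by exists c | | by exists b].
by exists t; rewrite cross // sE.
Qed.

Theorem proposition2p4 (L : finType) (R : seq (seq L * seq L))
    (R_atomic : atomic (presented_monoid R))
    (Ltilde_atoms : Ltilde R = atoms (presented_monoid R))
    (Delta : presented_monoid R) (Delta_fundamental : fundamental Delta) :
  (left_lcm_condition (presented_monoid R) <->
   right_gcd_condition (presented_monoid R)) /\
  (right_lcm_condition (presented_monoid R) <->
   left_gcd_condition (presented_monoid R)).
Proof.
have := fundamental_cross Delta_fundamental.
rewrite Ltilde_atoms => atom_cross.
have [nu [nu1 nuM]] := R_atomic; split.
  apply: (joins_iff_meets (divides_right_ranked nu1 nuM)) => [x y|].
    by exists 1; split; [exists x | exists y]; rewrite mulg1.
  apply: (@common_left_multiple _ Delta); apply: divides_right_power => // s.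
    by case/atom_cross.
  by case/atom_cross.
apply: (joins_iff_meets (divides_left_ranked nu1 nuM)) => [x y|].
  by exists 1; split; [exists x | exists y]; rewrite mul1g.
apply: (@common_right_multiple _ Delta); apply: divides_left_power => // s.
  by case/atom_cross.
by case/atom_cross.
Qed.
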